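(* Let $c\in(-1,1)$. For each $\theta>0$ choose $x_\theta\in\mathbb{Z}'$ such that $x_\theta-2c\sqrt\theta$ stays bounded as $\theta\to\infty$, and identify $\mathbb{Z}'$ with $\mathbb{Z}$ via $x=x_\theta+\tilde x$, $x\in\mathbb{Z}'$, $\tilde x\in\mathbb{Z}$, so that $\ell^2(\mathbb{Z}')$ is identified with $\ell^2(\mathbb{Z})$. Then, as $\theta\to\infty$, the selfadjoint operators $\frac{1}{\sqrt\theta}D^{\mathrm{Bessel}}_\theta$, transferred to $\ell^2(\mathbb{Z})$ by this identification, converge to the selfadjoint operator $D^{\mathrm{sine}}_c$ in the strong resolvent sense.
   Context: $\mathbb{Z}'=\mathbb{Z}+\tfrac12$ is the lattice of half-integers. $\ell^2_0(\mathbb{Z}')$ and $\ell^2_0(\mathbb{Z})$ are the dense subspaces of finitely supported functions in $\ell^2(\mathbb{Z}')$ and $\ell^2(\mathbb{Z})$. The difference operators $\mathcal{D}^{\mathrm{Bessel}}_\theta$ (on $\mathbb{Z}'$) and $\mathcal{D}^{\mathrm{sine}}_c$ (on $\mathbb{Z}$) act by $$\mathcal{D}^{\mathrm{Bessel}}_\theta f(x)=\sqrt\theta\, f(x+1)-xf(x)+\sqrt\theta\, f(x-1),\quad x\in\mathbb{Z}',$$ $$\mathcal{D}^{\mathrm{sine}}_c f(\tilde x)=f(\tilde x+1)-2c\,f(\tilde x)+f(\tilde x-1),\quad \tilde x\in\mathbb{Z}.$$ Considered as symmetric operators with domains $\ell^2_0(\mathbb{Z}')$ and $\ell^2_0(\mathbb{Z})$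 respectively, both are essentially selfadjoint; $D^{\mathrm{Bessel}}_\theta$ and $D^{\mathrm{sine}}_c$ denote their closures. Strong resolvent convergence $A_n\to A$ of selfadjoint operators means that $(A_n-\lambda)^{-1}\to(A-\lambda)^{-1}$ in the strong operator topology for every $\lambda\in\mathbb{C}\setminus\mathbb{R}$. *)

(* Defs.v *)
From HB Require Import structures.
From mathcomp Require Import all_boot all_order all_algebra.
From mathcomp Require Import all_classical all_reals all_analysis.
From mathcomp Require Import complex.
Import Order.TTheory GRing.Theory Num.Theory.
Import numFieldNormedType.Exports.

Set Implicit Arguments.
Unset Strict Implicit.
Unset Printing Implicit Defensive.

Local Open Scope classical_set_scope.
Local Open Scope ring_scope.

(* Valued in \bar R: it is +oo exactly when f is not square summable. *)
Definition ell2norm (R : realType) (I : choiceType) (f : I -> R[i]) : \bar R :=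
  sqrte (\esum_(x in [set: I]) ((complex.Re (f x)) ^+ 2 +
                                (complex.Im (f x)) ^+ 2)%:E)%E.

Definition ell2 (R : realType) (I : choiceType) : set (I -> R[i]) :=
  [set f | (ell2norm f < +oo)%E].

Definition ell2_0 (R : realType) (I : choiceType) : set (I -> R[i]) :=
  [set f | finite_set [set x | f x != 0]].

(* Meaningful for absolutely summable f. *)
Definition rsum (R : realType) (I : choiceType) (f : I -> R) : R :=
  fine (\esum_(x in [set: I]) (EFin \o f)^\+ x -
        \esum_(x in [set: I]) (EFin \o f)^\- x)%E.

(* Linear in the first argument; meaningful on ell2. *)
Definition ell2inner (R : realType) (I : choiceType) (f g : I -> R[i]) : R[i] :=
  Complex (rsum (fun x => complex.Re (f x * conjc (g x))))
          (rsum (fun x => complex.Im (f x * conjc (g x)))).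

(* Unbounded operators in ell^2(I; C), represented by their graphs:
   A (f, g) means that f is in the domain of A and A f = g. *)

Definition operator (R : realType) (I : choiceType) :=
  set ((I -> R[i]) * (I -> R[i])).

Definition op_restrict (R : realType) (I : choiceType)
    (T : (I -> R[i]) -> (I -> R[i])) (D : set (I -> R[i])) : operator R I :=
  [set p | D p.1 /\ p.2 = T p.1].

Definition op_closure (R : realType) (I : choiceType) (A : operator R I) :
    operator R I :=
  [set p | [/\ ell2 p.1, ell2 p.2 &
    forall e : R, 0 < e -> exists2 q, A q &
      (ell2norm (fun x => (q.1 x - p.1 x)%R) < e%:E)%E /\
      (ell2norm (fun x => (q.2 x - p.2 x)%R) < e%:E)%E]].

Definition op_adjoint (R : realType) (I : choiceType) (A : operator R I) :
    operator R I :=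
  [set p | [/\ ell2 p.1, ell2 p.2 &
    forall q, A q -> ell2inner q.2 p.1 = ell2inner q.1 p.2]].

Definition densely_defined (R : realType) (I : choiceType)
    (A : operator R I) : Prop :=
  forall f, ell2 f -> forall e : R, 0 < e ->
    exists2 p, A p & (ell2norm (fun x => (p.1 x - f x)%R) < e%:E)%E.

Definition selfadjoint (R : realType) (I : choiceType)
    (A : operator R I) : Prop :=
  densely_defined A /\ op_adjoint A = A.

Definition op_scale (R : realType) (I : choiceType) (a : R[i])
    (A : operator R I) : operator R I :=
  [set (p.1, fun x => a * p.2 x) | p in A].

(* The operator U A U^-1 for the unitary (U f)(y) = f (phi y), where phi is a
   bijection from J onto I. *)
Definition op_transfer (R : realType) (I J : choiceType) (phi : J -> I)
    (A : operator R I) : operator R J :=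
  [set (p.1 \o phi, p.2 \o phi) | p in A].

(* (A - lambda)^-1 g, that is, the f in the domain of A such that
   A f - lambda f = g; it exists and is unique for every g in ell2 when A is
   selfadjoint and lambda is not real (the value 0 is a dummy otherwise). *)
Definition resolvent (R : realType) (I : choiceType) (A : operator R I)
    (lambda : R[i]) (g : I -> R[i]) : I -> R[i] :=
  xget (fun=> 0) [set f | A (f, fun x => g x + lambda * f x)].

(* To be used for operators A t and B that are selfadjoint. *)
Definition strong_resolvent_cvg (R : realType) (I : choiceType) (T : Type)
    (F : set_system T) (A : T -> operator R I) (B : operator R I) : Prop :=
  forall lambda : R[i], complex.Im lambda != 0 ->
  forall g : I -> R[i], ell2 g ->
    (fun t => ell2norm (fun x => resolvent (A t) lambda g x -
                                 resolvent B lambda g x)) @ F --> 0%E.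

(* The lattice Z' = Z + 1/2: HalfInt n stands for n + 1/2. *)

Record halfint := HalfInt { hfloor : int }.

Lemma hfloorK : cancel hfloor HalfInt. Proof. by case. Qed.

HB.instance Definition _ := Choice.copy halfint (can_type hfloorK).

Definition hval (R : realType) (x : halfint) : R := (hfloor x)%:~R + 2^-1.

Definition hshift (x : halfint) (k : int) : halfint := HalfInt (hfloor x + k).

Lemma hvalD (R : realType) (x : halfint) (k : int) :
  hval R (hshift x k) = hval R x + k%:~R.
Proof. by rewrite /hval /= intrD addrAC. Qed.

Definition bessel_diff (R : realType) (theta : R) (f : halfint -> R[i]) :
    halfint -> R[i] := fun x =>
  real_complex R (Num.sqrt theta) * f (hshift x 1)
  - real_complex R (hval R x) * f x
  + real_complex R (Num.sqrt theta) * f (hshift x (- 1)).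

Definition sine_diff (R : realType) (c : R) (f : int -> R[i]) :
    int -> R[i] := fun x =>
  f (x + 1) - real_complex R (2 * c) * f x + f (x - 1).

Definition D_bessel (R : realType) (theta : R) : operator R halfint :=
  op_closure (op_restrict (bessel_diff theta) (@ell2_0 R halfint)).

Definition D_sine (R : realType) (c : R) : operator R int :=
  op_closure (op_restrict (sine_diff c) (@ell2_0 R int)).

(* theta^(-1/2) D_bessel theta, transferred to ell^2(Z) by x = x0 + y *)
Definition D_bessel_rescaled (R : realType) (theta : R) (x0 : halfint) :
    operator R int :=
  op_transfer (hshift x0)
    (op_scale (real_complex R (Num.sqrt theta)^-1) (D_bessel theta)).

(* Main.v *)
From HB Require Import structures.
Require Import Defs.
From mathcomp Require Import all_boot all_order all_algebra.
From mathcomp Require Import all_classical all_reals all_analysis.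
From mathcomp Require Import complex zify ring lra.
Import Order.TTheory GRing.Theory Num.Theory.
Import numFieldNormedType.Exports.

(** Divided by sqrt(theta) and read around the site x_theta, the Bessel operator
    becomes the Jacobi operator
      T f(y) = f(y+1) + v(y) f(y) + f(y-1)
    on Z with v(y) = - (x_theta + y) / sqrt(theta) [D_bessel_rescaledE]; the
    sine operator is the same with v = - 2c. The off-diagonal coefficients agree, and
    the diagonal ones converge at every site, because x_theta - 2c sqrt(theta) is
    bounded [cvg_bessel_diag]. The theorem is therefore an instance of two facts
    on Jacobi operators with an arbitrary real diagonal v.

    Selfadjointness. The off-diagonal part of T is bounded and the diagonal part
    commutes with cut-offs, so that the closure of T on finitely supported
    functions is the maximal operator, with domain all f in l^2 with T f in l^2
    [closure_jacobi]. This operator is symmetric, since the Wronskian of two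
    square-summable functions is summable and leaves no boundary term
    [jacobi_green], and its adjoint acts by T as well, as one sees by testing
    against point masses [selfadjoint_jacobi_max].

    Convergence. Symmetry gives the bound |Im lambda| |f| <= |(T - lambda) f|
    [jacobi_energy]. It makes all finite sections of T - lambda invertible, with
    uniformly bounded solutions, and a pointwise limit of these along an
    ultrafilter solves (T - lambda) f = g in l^2 [jacobi_solve]: this is the
    existence of the resolvent. Finally, let h be the resolvent of the limit operator
    applied to g, and u a finitely supported function close to h in the graph norm.
    On the finite support of u the diagonals converge uniformly, so that u nearly
    solves the equation of the approximating operators as well; by the bound,
    their resolvents applied to g are close to u, hence to h [resolvent_close,
    jacobi_strong_resolvent_cvg]. *)

Set Implicit Arguments.
Unset Strict Implicit.
Unset Printing Implicit Defensive.

Local Open Scope classical_set_scope.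
Local Open Scope ring_scope.

(** * Sums of real families *)

Section RealSums.
Context {R : realType} {I : choiceType}.
Implicit Types (u v p q : I -> R) (A : set I).

Definition rsummable u := summable [set: I] (EFin \o u).

Lemma rsummable_le u v :
  (forall x, `|u x| <= v x) -> rsummable v -> rsummable u.
Proof.
move=> uv; apply: le_lt_trans; apply: le_esum => x _ /=.
by rewrite lee_fin (le_trans (uv x))// ler_norm.
Qed.

Lemma rsummableD u v :
  rsummable u -> rsummable v -> rsummable (fun x => u x + v x).
Proof. exact: summableD. Qed.

Lemma rsummableN u : rsummable u -> rsummable (fun x => - u x).
Proof. by rewrite /rsummable summableN. Qed.

Lemma esumZ (a : R) u : 0 <= a -> (forall x, 0 <= u x) ->
  (\esum_(x in [set: I]) (a * u x)%:E = a%:E * \esum_(x in [set: I]) (u x)%:E)%E.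
Proof.
move=> a0 u0.
have le_ (b : R) (w : I -> R) : 0 <= b -> (forall x, 0 <= w x) ->
    (\esum_(x in [set: I]) (b * w x)%:E <=
     b%:E * \esum_(x in [set: I]) (w x)%:E)%E.
  move=> b0 w0; apply: ge_ereal_sup => _ [X [finX _]] <-.
  under eq_fsbigr do rewrite EFinM.
  rewrite -ge0_mule_fsumr//.
  apply: lee_wpmul2l; first by rewrite lee_fin.
  by apply: esum_ge; exists X.
apply/eqP; rewrite eq_le le_//=.
have [->|an0] := eqVneq a 0; first by rewrite mul0e esum_ge0// => x _; rewrite mul0r.
have -> : (\esum_(x in [set: I]) (u x)%:E =
           \esum_(x in [set: I]) (a^-1 * (a * u x))%:E)%E.
  by apply: eq_esum => x _; rewrite mulKf.
apply: (le_trans (lee_wpmul2l _ (le_ a^-1 (fun x => a * u x) _ _))).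
- by rewrite lee_fin.
- by rewrite invr_ge0.
- by move=> x; rewrite mulr_ge0.
by rewrite muleA -EFinM divff// mul1e.
Qed.

Lemma ge0_rsummable u : (forall x, 0 <= u x) ->
  rsummable u <-> (\esum_(x in [set: I]) (u x)%:E \is a fin_num)%E.
Proof.
move=> u0; rewrite /rsummable summableE.
by under eq_esum do rewrite /= ger0_norm//.
Qed.

Lemma rsum_sub p q : (forall x, 0 <= p x) -> (forall x, 0 <= q x) ->
  rsummable p -> rsummable q ->
  rsum (fun x => p x - q x) = fine (\esum_(x in [set: I]) (p x)%:E)%E -
                              fine (\esum_(x in [set: I]) (q x)%:E)%E.
Proof.
move=> p0 q0 sp sq.
rewrite /rsum [X in fine X](esumB sp sq) => [|x _|x _]; rewrite ?lee_fin//.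
by rewrite fineB//; apply/ge0_rsummable.
Qed.

Lemma rsummable0 : rsummable (fun=> 0).
Proof. by rewrite /rsummable /summable esum1// => x _ /=; rewrite normr0. Qed.

Lemma esum_rsum u : (forall x, 0 <= u x) -> rsummable u ->
  (\esum_(x in [set: I]) (u x)%:E = (rsum u)%:E)%E.
Proof.
move=> u0 su; rewrite (_ : rsum u = rsum (fun x => u x - 0)); last first.
  by congr rsum; apply/funext => x; rewrite subr0.
rewrite rsum_sub//; last exact: rsummable0.
by rewrite (esum1 (a := fun=> 0%:E))//= subr0 fineK//; apply/ge0_rsummable.
Qed.

(** Sums of extended reals are additive for nonnegative terms; this splitting
    extends linearity from such families to all summable ones. *)
Lemma rsummable_split u : rsummable u -> exists p q,
  [/\ forall x, 0 <= p x, forall x, 0 <= q x, rsummable p, rsummable q &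
      u = (fun x => p x - q x)].
Proof.
move=> su; exists (fun x => `|u x|), (fun x => `|u x| - u x).
have sn : rsummable (fun x => `|u x|).
  by apply: le_lt_trans su; apply: le_esum => x _ /=; rewrite normr_id.
split => //.
- by move=> x; rewrite subr_ge0 ler_norm.
- by apply: rsummableD => //; exact: rsummableN.
- by apply/funext => x; rewrite opprB addrC subrK.
Qed.

Lemma rsumD u v : rsummable u -> rsummable v ->
  rsum (fun x => u x + v x) = rsum u + rsum v.
Proof.
move=> /rsummable_split[p [q [p0 q0 sp sq ->]]].
move=> /rsummable_split[p' [q' [p'0 q'0 sp' sq' ->]]].
rewrite !rsum_sub//.
have esum_add a b : (forall x, 0 <= a x) -> (forall x, 0 <= b x) ->
    rsummable a -> rsummable b ->
    fine (\esum_(x in [set: I]) (a x + b x)%:E)%E =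
    fine (\esum_(x in [set: I]) (a x)%:E)%E +
    fine (\esum_(x in [set: I]) (b x)%:E)%E.
  move=> a0 b0 sa sb; rewrite -fineD; try exact/ge0_rsummable.
  by rewrite -esumD// => x _; rewrite lee_fin.
rewrite addrACA -opprD -!esum_add// -rsum_sub//; try exact: rsummableD.
- by congr rsum; apply/funext => x; ring.
- by move=> x; rewrite addr_ge0.
- by move=> x; rewrite addr_ge0.
Qed.

Lemma rsumN u : rsummable u -> rsum (fun x => - u x) = - rsum u.
Proof.
move=> /rsummable_split[p [q [p0 q0 sp sq ->]]].
rewrite rsum_sub// opprB -rsum_sub//.
by congr rsum; apply/funext => x; rewrite opprB.
Qed.

Lemma rsumB u v : rsummable u -> rsummable v ->
  rsum (fun x => u x - v x) = rsum u - rsum v.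
Proof. by move=> su sv; rewrite rsumD ?rsumN//; exact: rsummableN. Qed.

Lemma ge0_rsummableZ a u : 0 <= a -> rsummable u -> rsummable (fun x => a * u x).
Proof.
move=> a0; rewrite /rsummable !summableE => su.
under eq_esum => x _ do rewrite /= normrM (ger0_norm a0).
by rewrite esumZ// fin_numM.
Qed.

Lemma rsummableZ a u : rsummable u -> rsummable (fun x => a * u x).
Proof.
move=> su; have [a0|a0] := leP 0 a; first exact: ge0_rsummableZ.
rewrite (_ : (fun x => a * u x) = (fun x => - ((- a) * u x))); last first.
  by apply/funext => x; ring.
by apply/rsummableN/ge0_rsummableZ => //; rewrite oppr_ge0 ltW.
Qed.

Lemma rsumZ a u : rsummable u -> rsum (fun x => a * u x) = a * rsum u.
Proof.
have pos b w : 0 <= b -> rsummable w -> rsum (fun x => b * w x) = b * rsum w.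
  move=> b0 /rsummable_split[p [q [p0 q0 sp sq ->]]].
  rewrite (_ : (fun x => b * _) = (fun x => b * p x - b * q x)); last first.
    by apply/funext => x; ring.
  rewrite !rsum_sub//; try exact: rsummableZ; try by move=> x; rewrite mulr_ge0.
  by rewrite !esumZ// !fineM ?mulrBr//; apply/ge0_rsummable.
move=> su; have [a0|a0] := leP 0 a; first exact: pos.
rewrite (_ : (fun x => a * u x) = (fun x => - ((- a) * u x))); last first.
  by apply/funext => x; ring.
by rewrite rsumN ?pos//; [ring|rewrite oppr_ge0 ltW|exact: rsummableZ].
Qed.

Lemma rsum_ge0 u : (forall x, 0 <= u x) -> rsummable u -> 0 <= rsum u.
Proof.
move=> u0 su; rewrite -lee_fin -esum_rsum// esum_ge0// => x _.
by rewrite lee_fin.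
Qed.

Lemma le_rsum u v : (forall x, u x <= v x) -> rsummable u -> rsummable v ->
  rsum u <= rsum v.
Proof.
move=> uv su sv; rewrite -subr_ge0 -rsumB//.
by apply: rsum_ge0 => [x|]; [rewrite subr_ge0|exact/rsummableD/rsummableN].
Qed.

Lemma le_rsum_term u x : (forall y, 0 <= u y) -> rsummable u -> u x <= rsum u.
Proof.
move=> u0 su; rewrite -lee_fin -esum_rsum//.
apply: esum_ge; exists [set x]; first by split.
by rewrite fsbig_set1.
Qed.

Lemma rsummable_finite A u : finite_set A -> (forall x, ~ A x -> u x = 0) ->
  rsummable u.
Proof.
move=> finA u0; rewrite /rsummable /summable (esumID A)// setTI.
rewrite [X in (_ + X)%E]esum1 ?adde0; last first.
  by move=> x [_ /u0 ux]; rewrite /= ux normr0.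
rewrite esum_fset// fsbig_finite//=.
by apply: lte_sum_pinfty => x _; rewrite ltry.
Qed.

Lemma rsum_single u y : (forall x, x != y -> u x = 0) -> rsum u = u y.
Proof.
move=> uy; have single p : (forall x, 0 <= p x) -> (forall x, x != y -> p x = 0) ->
    rsummable p /\ (\esum_(x in [set: I]) (p x)%:E = (p y)%:E)%E.
  move=> p0 py; split.
    apply: (rsummable_finite (finite_set1 y)) => x /eqP xy; exact: py.
  rewrite (esumID [set y])// => [|x _]; last by rewrite lee_fin.
  rewrite setTI esum_set1 ?lee_fin// esum1 ?adde0// => x [_ /eqP xy].
  by rewrite py.
have [||sp ep] := single (fun x => `|u x|) => //.
  by move=> x /uy ->; rewrite normr0.
have [||sq eq] := single (fun x => `|u x| - u x).
- by move=> x; rewrite subr_ge0 ler_norm.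
- by move=> x /uy ->; rewrite normr0 subr0.
rewrite (_ : rsum u = rsum (fun x => `|u x| - (`|u x| - u x))); last first.
  by congr rsum; apply/funext => x; ring.
rewrite rsum_sub// => [|x]; last by rewrite subr_ge0 ler_norm.
by rewrite ep eq/=; ring.
Qed.

(** The partial sums over finite sets approach the total, so that what is left
    outside a large finite set is small. *)
Lemma rsum_tail u e : (forall x, 0 <= u x) -> rsummable u -> 0 < e ->
  exists2 A, finite_set A & rsum (fun x => if x \in A then 0 else u x) < e.
Proof.
move=> u0 su e0.
have : ((rsum u - e)%:E < \esum_(x in [set: I]) (u x)%:E)%E.
  by rewrite esum_rsum// lte_fin ltrBlDr ltrDl.
move=> /ereal_sup_gt[_ [A [finA _] <-]] uA; exists A => //.
rewrite -lte_fin -esum_rsum; last 2 first.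
- by move=> x; case: ifP.
- apply: (rsummable_le _ su) => x; case: ifP => _; first by rewrite normr0.
  by rewrite ger0_norm.
have u0' x : [set: I] x -> (0 <= (u x)%:E)%E by rewrite lee_fin.
have := esumID A setT (fun x => (u x)%:E) u0'; rewrite esum_rsum// setTI.
rewrite (_ : esum A _ = \sum_(x \in A) (u x)%:E)%E; last first.
  by rewrite esum_fset// => x _; rewrite lee_fin.
rewrite setTI (esum_mkcond (~` A)).
rewrite (@eq_esum _ _ _ _ (fun x => (if x \in A then 0 else u x)%:E));
  last by move=> x _; rewrite in_setC; case: (x \in A).
move=> eu; move: uA; rewrite EFinB eu.
by rewrite lteBlDr// lteD2lE// fsbig_finite// sumEFin.
Qed.
End RealSums.

(** * Complex numbers by coordinates *)

Section ComplexCoordinates.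
Context {R : realType}.
Implicit Types z w : R[i].

Lemma cReD z w : complex.Re (z + w) = complex.Re z + complex.Re w.
Proof. by case: z; case: w. Qed.

Lemma cImD z w : complex.Im (z + w) = complex.Im z + complex.Im w.
Proof. by case: z; case: w. Qed.

Lemma cReN z : complex.Re (- z) = - complex.Re z.
Proof. by case: z. Qed.

Lemma cImN z : complex.Im (- z) = - complex.Im z.
Proof. by case: z. Qed.

Lemma cReM z w : complex.Re (z * w) =
  complex.Re z * complex.Re w - complex.Im z * complex.Im w.
Proof. by case: z; case: w. Qed.

Lemma cImM z w : complex.Im (z * w) =
  complex.Re z * complex.Im w + complex.Im z * complex.Re w.
Proof. by case: z; case: w. Qed.

Lemma cReJ z : complex.Re (conjc z) = complex.Re z.
Proof. by case: z. Qed.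

Lemma cImJ z : complex.Im (conjc z) = - complex.Im z.
Proof. by case: z. Qed.

Definition ReImE := (cReD, cImD, cReN, cImN, cReM, cImM, cReJ, cImJ).

Lemma complex_ext z w :
  complex.Re z = complex.Re w -> complex.Im z = complex.Im w -> z = w.
Proof. by case: z; case: w => a b c d /= -> ->. Qed.

Definition sqmod z : R := complex.Re z ^+ 2 + complex.Im z ^+ 2.

Lemma sqmod_ge0 z : 0 <= sqmod z.
Proof. by rewrite addr_ge0 ?sqr_ge0. Qed.

Lemma sqmod0 : sqmod 0 = 0.
Proof. by rewrite /sqmod/= expr0n addr0. Qed.

Lemma sqmod_real (r : R) : sqmod (real_complex R r) = r ^+ 2.
Proof. by rewrite /sqmod/= expr0n addr0. Qed.

Lemma sqmodN z : sqmod (- z) = sqmod z.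
Proof. by rewrite /sqmod !ReImE !sqrrN. Qed.

Lemma sqmodM z w : sqmod (z * w) = sqmod z * sqmod w.
Proof. by case: z w => a b [c d]; rewrite /sqmod !ReImE/=; ring. Qed.

Lemma sqmodD z w : sqmod (z + w) <= 2 * sqmod z + 2 * sqmod w.
Proof.
have := sqmod_ge0 (z - w); rewrite -[in X in _ -> X]subr_ge0.
by case: z w => a b [c d]; rewrite /sqmod !ReImE/=; congr (_ <= _); ring.
Qed.

Lemma sqmod_eq0 z : sqmod z <= 0 -> z = 0.
Proof.
rewrite le_eqVlt ltNge sqmod_ge0 orbF paddr_eq0 ?sqr_ge0// !sqrf_eq0.
by move=> /andP[/eqP zR /eqP zI]; exact: complex_ext.
Qed.

Lemma ReMJ_le z w : `|complex.Re (z * conjc w)| <= sqmod z + sqmod w.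
Proof.
have := sqr_ge0 (complex.Re z - complex.Re w).
have := sqr_ge0 (complex.Re z + complex.Re w).
have := sqr_ge0 (complex.Im z - complex.Im w).
have := sqr_ge0 (complex.Im z + complex.Im w).
by rewrite /sqmod !ReImE ler_norml; case: z w => a b [c d]/= *; apply/andP; split; nra.
Qed.

Lemma ImMJ_le z w : `|complex.Im (z * conjc w)| <= sqmod z + sqmod w.
Proof.
have := sqr_ge0 (complex.Re z - complex.Im w).
have := sqr_ge0 (complex.Re z + complex.Im w).
have := sqr_ge0 (complex.Im z - complex.Re w).
have := sqr_ge0 (complex.Im z + complex.Re w).
by rewrite /sqmod !ReImE ler_norml; case: z w => a b [c d]/= *; apply/andP; split; nra.
Qed.

End ComplexCoordinates.

(** * Square-summable functions *)

Section Ell2.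
Context {R : realType} {I : choiceType}.
Implicit Types (f g : I -> R[i]) (A : set I).

Definition ell2sq f : R := rsum (fun x => sqmod (f x)).

Lemma ell2P f : ell2 f <-> rsummable (fun x => sqmod (f x)).
Proof.
have pos x : 0 <= sqmod (f x) := sqmod_ge0 _.
have e0 : (0 <= \esum_(x in [set: I]) (sqmod (f x))%:E)%E.
  by apply: esum_ge0 => x _; rewrite lee_fin.
rewrite ge0_rsummable// /ell2/= /ell2norm.
rewrite -[esum _ _]/(\esum_(x in _) (sqmod (f x))%:E)%E.
rewrite -ge0_fin_numE; last exact: sqrte_ge0.
by rewrite sqrte_fin_num.
Qed.

Lemma ell2normE f : ell2 f -> ell2norm f = (Num.sqrt (ell2sq f))%:E.
Proof.
move=> /ell2P sf; rewrite /ell2norm.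
rewrite -[esum _ _]/(\esum_(x in _) (sqmod (f x))%:E)%E esum_rsum//.
by move=> x; exact: sqmod_ge0.
Qed.

Lemma ell2sq_ge0 f : ell2 f -> 0 <= ell2sq f.
Proof. by move=> /ell2P sf; apply: rsum_ge0 => // x; exact: sqmod_ge0. Qed.

Lemma ell2norm_lt f e : 0 < e ->
  (ell2norm f < e%:E)%E <-> ell2 f /\ ell2sq f < e ^+ 2.
Proof.
move=> e0; split => [fe|[f2 fe]].
  have f2 : ell2 f by apply: (lt_trans fe); rewrite ltry.
  split=> //; move: fe; rewrite ell2normE// lte_fin => fe.
  by rewrite -[ltLHS]sqr_sqrtr ?ell2sq_ge0// ltrXn2r// ?nnegrE ?sqrtr_ge0// ltW.
rewrite ell2normE// lte_fin -(ger0_norm (ltW e0)) -sqrtr_sqr ltr_sqrt//.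
by rewrite exprn_gt0.
Qed.

Lemma le_ell2sq f g : (forall x, sqmod (f x) <= sqmod (g x)) ->
  ell2 g -> ell2 f /\ ell2sq f <= ell2sq g.
Proof.
move=> fg /ell2P sg; have sf : rsummable (fun x => sqmod (f x)).
  by apply: rsummable_le sg => x; rewrite ger0_norm// sqmod_ge0.
by split; [exact/ell2P|exact: le_rsum].
Qed.

Lemma ell2D f g : ell2 f -> ell2 g -> ell2 (fun x => f x + g x).
Proof.
move=> /ell2P sf /ell2P sg; apply/ell2P.
apply: (rsummable_le _ (rsummableD (rsummableZ 2 sf) (rsummableZ 2 sg))) => x.
by rewrite ger0_norm ?sqmod_ge0// sqmodD.
Qed.

Lemma ell2sqD f g : ell2 f -> ell2 g ->
  ell2sq (fun x => f x + g x) <= 2 * ell2sq f + 2 * ell2sq g.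
Proof.
move=> f2 g2; move: (f2) (g2) => /ell2P sf /ell2P sg.
rewrite /ell2sq -!rsumZ// -rsumD; try exact: rsummableZ.
apply: le_rsum => [x||]; first exact: sqmodD.
- exact/ell2P/ell2D.
- by apply: rsummableD; exact: rsummableZ.
Qed.

Lemma ell2Z a f : ell2 f -> ell2 (fun x => a * f x).
Proof.
move=> /ell2P sf; apply/ell2P; apply: (rsummable_le _ (rsummableZ (sqmod a) sf)).
by move=> x; rewrite ger0_norm ?sqmod_ge0// sqmodM.
Qed.

Lemma ell2sqZ a f : ell2 f -> ell2sq (fun x => a * f x) = sqmod a * ell2sq f.
Proof.
move=> /ell2P sf; rewrite /ell2sq -rsumZ//.
by congr rsum; apply/funext => x; rewrite sqmodM.
Qed.

Lemma ell2sqN f : ell2sq (fun x => - f x) = ell2sq f.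
Proof. by congr rsum; apply/funext => x; rewrite sqmodN. Qed.

Lemma ell2N f : ell2 f -> ell2 (fun x => - f x).
Proof. by case/(@le_ell2sq (fun x => - f x) f) => // x; rewrite sqmodN. Qed.

Lemma ell2B f g : ell2 f -> ell2 g -> ell2 (fun x => f x - g x).
Proof. by move=> f2 /ell2N; exact: ell2D. Qed.

Lemma ell2sqB f g : ell2 f -> ell2 g ->
  ell2sq (fun x => f x - g x) <= 2 * ell2sq f + 2 * ell2sq g.
Proof. by move=> f2 g2; rewrite -(ell2sqN g) ell2sqD//; exact: ell2N. Qed.

Lemma le_ell2sq_term f x : ell2 f -> sqmod (f x) <= ell2sq f.
Proof.
move=> /ell2P sf; apply: (@le_rsum_term _ _ (fun x => sqmod (f x))) => // y.
exact: sqmod_ge0.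
Qed.

Lemma ell2sq_eq0 f : ell2 f -> ell2sq f <= 0 -> f = (fun=> 0).
Proof.
move=> f2 f0; apply/funext => x; apply/sqmod_eq0.
by apply: le_trans f0; exact: le_ell2sq_term.
Qed.

Lemma ell2_0_ell2 f : ell2_0 f -> ell2 f.
Proof.
move=> ff; apply/ell2P; apply: (rsummable_finite ff) => x /negP.
by rewrite negbK => /eqP ->; rewrite sqmod0.
Qed.

Lemma rsummable_ReMJ f g : ell2 f -> ell2 g ->
  rsummable (fun x => complex.Re (f x * conjc (g x))).
Proof.
move=> /ell2P sf /ell2P sg; apply: (rsummable_le _ (rsummableD sf sg)) => x.
exact: ReMJ_le.
Qed.

Lemma rsummable_ImMJ f g : ell2 f -> ell2 g ->
  rsummable (fun x => complex.Im (f x * conjc (g x))).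
Proof.
move=> /ell2P sf /ell2P sg; apply: (rsummable_le _ (rsummableD sf sg)) => x.
exact: ImMJ_le.
Qed.

Definition trunc A f x := if x \in A then f x else 0.

Lemma trunc_ell2_0 A f : finite_set A -> ell2_0 (trunc A f).
Proof.
move=> finA; apply: sub_finite_set finA => x /=; rewrite /trunc.
by case: ifPn => [/set_mem|]; rewrite ?eqxx.
Qed.

(** One set serves both functions, because the tail of the sum of their squares
    dominates both tails. The second function is meant to be the diagonal part
    of a Jacobi operator applied to the first. *)
Lemma ell2_trunc2 f g e : ell2 f -> ell2 g -> 0 < e ->
  exists2 A, finite_set A & [/\ ell2sq (fun x => trunc A f x - f x) < e &
                                ell2sq (fun x => trunc A g x - g x) < e].
Proof.
move=> /ell2P sf /ell2P sg e0.
have [|A finA Ae] := rsum_tail _ (rsummableD sf sg) e0.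
  by move=> x; rewrite addr_ge0 ?sqmod_ge0.
exists A => //.
suff small h : (forall x, sqmod (h x) <= sqmod (f x) + sqmod (g x)) ->
    ell2sq (fun x => trunc A h x - h x) < e.
  by split; apply: small => x; rewrite ?lerDl ?lerDr sqmod_ge0.
move=> hfg; apply: le_lt_trans Ae.
have le x : sqmod (trunc A h x - h x) <=
    (if x \in A then 0 else sqmod (f x) + sqmod (g x)).
  rewrite /trunc; case: ifP => _; first by rewrite subrr sqmod0.
  by rewrite sub0r sqmodN.
have sA : rsummable (fun x => if x \in A then 0 else sqmod (f x) + sqmod (g x)).
  apply: rsummable_le (rsummableD sf sg) => x; case: ifP => _.
    by rewrite normr0 addr_ge0 ?sqmod_ge0.
  by rewrite ger0_norm// addr_ge0 ?sqmod_ge0.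
apply: le_rsum => //; apply: rsummable_le sA => x.
by rewrite ger0_norm ?sqmod_ge0.
Qed.

End Ell2.

Section Reindexing.
Context {R : realType} {I J : choiceType}.
Context {phi : J -> I} (bphi : bijective phi).

Let sbphi : set_bij setT setT phi.
Proof. by rewrite setTT_bijective. Qed.

Lemma rsum_reindex (u : I -> R) : rsum (u \o phi) = rsum u.
Proof.
rewrite /rsum -[EFin \o (u \o phi)]/((EFin \o u) \o phi).
by rewrite funepos_comp funeneg_comp !(reindex_esum _ _ phi _ sbphi).
Qed.

Lemma rsummable_reindex (u : I -> R) : rsummable u -> rsummable (u \o phi).
Proof.
by apply: le_lt_trans; rewrite [leRHS](reindex_esum _ _ phi _ sbphi).
Qed.

Lemma ell2norm_reindex (f : I -> R[i]) : ell2norm (f \o phi) = ell2norm f.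
Proof. by congr sqrte; rewrite [RHS](reindex_esum _ _ phi _ sbphi). Qed.

End Reindexing.

(** * Jacobi operators and their closures *)

Section Jacobi.
Context {R : realType}.
Implicit Types (v : int -> R) (f g : int -> R[i]).

Definition jacobi v f : int -> R[i] := fun x =>
  f (x + 1) + real_complex R (v x) * f x + f (x - 1).

Definition jacobi_max v : operator R int :=
  [set p | [/\ ell2 p.1, ell2 p.2 & p.2 = jacobi v p.1]].

Lemma bijective_addr (k : int) : bijective (fun x : int => x + k).
Proof. by exists (fun x => x - k) => x; rewrite ?addrK ?subrK. Qed.

Lemma ell2_shift f k : ell2 f -> ell2 (fun x => f (x + k)).
Proof.
move=> /ell2P sf; apply/ell2P.
exact: (rsummable_reindex (bijective_addr k) sf).
Qed.

Lemma ell2sq_shift f k : ell2sq (fun x => f (x + k)) = ell2sq f.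
Proof. exact: (rsum_reindex (bijective_addr k) (fun x => sqmod (f x))). Qed.

Lemma jacobiB v f g x :
  jacobi v (fun y => f y - g y) x = jacobi v f x - jacobi v g x.
Proof. by rewrite /jacobi; ring. Qed.

Lemma ell2_jacobi v f : ell2 f -> ell2 (fun x => real_complex R (v x) * f x) ->
  ell2 (jacobi v f) /\
  ell2sq (jacobi v f) <=
    6 * ell2sq f + 4 * ell2sq (fun x => real_complex R (v x) * f x).
Proof.
move=> f2 vf2; have f1 := ell2_shift 1 f2; have fm := ell2_shift (- 1) f2.
have fv := ell2D f1 vf2; split; first exact: ell2D.
have := ell2sqD fv fm; have := ell2sqD f1 vf2; rewrite !ell2sq_shift.
by rewrite -[ell2sq (fun x => _ + _ + _)]/(ell2sq (jacobi v f)); lra.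
Qed.

Lemma ell2_diag v f : ell2 f -> ell2 (jacobi v f) ->
  ell2 (fun x => real_complex R (v x) * f x).
Proof.
move=> f2 Tf2; rewrite (_ : (fun x => _) =
    (fun x => jacobi v f x - f (x + 1) - f (x + - 1))); last first.
  by apply/funext => x; rewrite /jacobi; ring.
by apply: ell2B; [apply: ell2B|]; rewrite //; exact: ell2_shift.
Qed.

Lemma ell2_0_diag v f : ell2_0 f -> ell2_0 (fun x => real_complex R (v x) * f x).
Proof.
apply: sub_finite_set => x /=; apply: contra => /eqP ->.
by rewrite mulr0.
Qed.

Lemma ell2_0_jacobi v f : ell2_0 f -> ell2 (jacobi v f).
Proof.
move=> f0; have [] // := @ell2_jacobi v f; apply: ell2_0_ell2 => //.
exact: ell2_0_diag.
Qed.

Lemma ell2_0_sub_jacobi_max v :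
  op_restrict (jacobi v) (@ell2_0 R int) `<=` jacobi_max v.
Proof.
move=> [f g] [/= f0 ->]; split => //=; first exact: ell2_0_ell2.
exact: ell2_0_jacobi.
Qed.

(** Cutting a function of the maximal domain off outside a large finite set
    approximates it in the graph norm: the off-diagonal part is bounded, and
    the diagonal part commutes with the cut-off. *)
Lemma jacobi_max_core v f e : ell2 f -> ell2 (jacobi v f) -> 0 < e ->
  exists u, [/\ ell2_0 u, ell2sq (fun x => u x - f x) < e &
                ell2sq (fun x => jacobi v u x - jacobi v f x) < e].
Proof.
move=> f2 Tf2 e0; have vf2 := ell2_diag f2 Tf2.
have e10 : 0 < e / 10 by lra.
have [A finA [Af Avf]] := ell2_trunc2 f2 vf2 e10.
have u0 := trunc_ell2_0 f finA.
exists (trunc A f); split => //; first by apply: lt_trans Af _; lra.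
have uf2 : ell2 (fun x => trunc A f x - f x).
  by apply: ell2B => //; exact: ell2_0_ell2.
have vE : (fun x => real_complex R (v x) * (trunc A f x - f x)) =
    (fun x => trunc A (fun x => real_complex R (v x) * f x) x -
              real_complex R (v x) * f x).
  by apply/funext => x; rewrite /trunc mulrBr; case: ifP; rewrite ?mulr0.
have vuf2 : ell2 (fun x => real_complex R (v x) * (trunc A f x - f x)).
  by rewrite vE; apply: ell2B => //; exact/ell2_0_ell2/trunc_ell2_0.
have [_] := ell2_jacobi uf2 vuf2; rewrite vE.
rewrite (_ : jacobi v _ = fun x => jacobi v (trunc A f) x - jacobi v f x);
  last by apply/funext => x; rewrite jacobiB.
by move=> /le_lt_trans; apply; lra.
Qed.

Lemma op_closureP (I : choiceType) (A : operator R I) (f g : I -> R[i]) :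
  (forall p, A p -> ell2 p.1 /\ ell2 p.2) ->
  op_closure A (f, g) <-> [/\ ell2 f, ell2 g & forall e : R, 0 < e ->
    exists2 q, A q & ell2sq (fun x => q.1 x - f x) < e /\
                     ell2sq (fun x => q.2 x - g x) < e].
Proof.
move=> A2; split=> -[/= f2 g2 cl]; split => //= e e0.
  have se0 : 0 < Num.sqrt e by rewrite sqrtr_gt0.
  have [q Aq [/(ell2norm_lt _ se0)[_ q1] /(ell2norm_lt _ se0)[_ q2]]] := cl _ se0.
  by exists q => //; rewrite sqr_sqrtr ?ltW// in q1 q2.
have [|q Aq [q1 q2]] := cl (e ^+ 2); first by rewrite exprn_gt0.
have [? ?] := A2 _ Aq.
by exists q => //; split; apply/ell2norm_lt => //; split=> //; exact: ell2B.
Qed.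

(** Convergence in norm implies pointwise convergence, and the difference
    expression at a site involves three values only: so the graph of the maximal
    operator is closed, and the closure cannot exceed it. *)
Lemma closure_jacobi v :
  op_closure (op_restrict (jacobi v) (@ell2_0 R int)) = jacobi_max v.
Proof.
have A2 p : op_restrict (jacobi v) (@ell2_0 R int) p -> ell2 p.1 /\ ell2 p.2.
  by move=> /ell2_0_sub_jacobi_max [].
apply/seteqP; split=> -[f g]; last first.
  move=> [/= f2 g2 gE]; apply/(op_closureP _ _ A2); split => // e e0.
  have Tf2 : ell2 (jacobi v f) by rewrite -gE.
  have [u [u0 uf Tuf]] := jacobi_max_core f2 Tf2 e0.
  exists (u, jacobi v u) => //=; split => //; rewrite gE; exact: Tuf.
move=> /(op_closureP _ _ A2)[f2 g2 cl]; split => //=; apply/funext => x.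
apply/eqP; rewrite -subr_eq0; apply/eqP/sqmod_eq0.
apply/ler_addgt0Pr => e e0; rewrite add0r.
(* [g x - T f x] is bounded in terms of the squared distances, with the
   constant [K] that the triangle inequalities below produce. *)
pose K : R := 14 + 8 * v x ^+ 2.
have K0 : 0 < K by rewrite /K; have := sqr_ge0 (v x); lra.
have [|[u Tu] [/= u0 ->] [/= uf Tug]] := cl (e / K); first by rewrite divr_gt0.
have u2 := ell2_0_ell2 u0.
have d2 : ell2 (fun y => u y - f y) by exact: ell2B.
have r2 : ell2 (fun y => jacobi v u y - g y).
  by apply: ell2B => //; exact: ell2_0_jacobi.
have d y : sqmod (u y - f y) <= e / K.
  by apply: le_trans (ltW uf); exact: (le_ell2sq_term y d2).
have r : sqmod (jacobi v u x - g x) <= e / K.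
  by apply: le_trans (ltW Tug); exact: (le_ell2sq_term x r2).
have Td : sqmod (jacobi v (fun y => u y - f y) x) <= (6 + 4 * v x ^+ 2) * (e / K).
  apply: le_trans (sqmodD _ _) _.
  have := sqmodD (u (x + 1) - f (x + 1)) (real_complex R (v x) * (u x - f x)).
  rewrite sqmodM sqmod_real.
  have := d (x + 1); have := d x; have := d (x - 1).
  have := ler_wpM2l (sqr_ge0 (v x)) (d x).
  by move: (e / K) => E; move: (v x ^+ 2) => V; lra.
rewrite (_ : g x - jacobi v f x =
    jacobi v (fun y => u y - f y) x - (jacobi v u x - g x)); last first.
  by rewrite jacobiB; ring.
apply: le_trans (sqmodD _ _) _; rewrite sqmodN.
have -> : e = 2 * ((6 + 4 * v x ^+ 2) * (e / K)) + 2 * (e / K).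
  by rewrite /K; field; rewrite -/K gt_eqF.
by apply: lerD; rewrite ler_pM2l.
Qed.

(** * Symmetry and selfadjointness *)

Lemma telescoping_rsum (F G w : int -> R) :
  rsummable F -> rsummable G -> rsummable w ->
  (forall x, F x = G x + (w x - w (x + - 1))) -> rsum F = rsum G.
Proof.
move=> sF sG sw FE; rewrite (_ : F = fun x => G x + (w x - w (x + - 1))); last first.
  exact/funext.
have sw1 : rsummable (fun x => w (x + - 1)).
  exact: (rsummable_reindex (bijective_addr (- 1)) sw).
rewrite rsumD ?rsumB//; last by apply: rsummableD => //; exact: rsummableN.
have -> : rsum (fun x => w (x + - 1)) = rsum w.
  exact: (rsum_reindex (bijective_addr (- 1)) w).
by rewrite subrr addr0.
Qed.

(** Green's identity: the two sides differ by the increments of the Wronskian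
    f(x+1) g(x)^* - f(x) g(x+1)^*, a summable function, so that no boundary
    term remains. *)
Lemma jacobi_green v f g : ell2 f -> ell2 g ->
  rsummable (fun x => complex.Re (jacobi v f x * conjc (g x))) ->
  rsummable (fun x => complex.Im (jacobi v f x * conjc (g x))) ->
  rsummable (fun x => complex.Re (f x * conjc (jacobi v g x))) ->
  rsummable (fun x => complex.Im (f x * conjc (jacobi v g x))) ->
  ell2inner (jacobi v f) g = ell2inner f (jacobi v g).
Proof.
move=> f2 g2 sFR sFI sGR sGI.
pose W x := f (x + 1) * conjc (g x) - f x * conjc (g (x + 1)).
have green x : jacobi v f x * conjc (g x) =
    f x * conjc (jacobi v g x) + (W x - W (x + - 1)).
  rewrite /W /jacobi subrK; move: (f _) (f _) (f _) (g _) (g _) (g _) (v _).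
  move=> [a1 b1] [a2 b2] [a3 b3] [c1 d1] [c2 d2] [c3 d3] r.
  by apply: complex_ext; rewrite !ReImE/=; ring.
have f1 := ell2_shift 1 f2; have g1 := ell2_shift 1 g2.
congr Complex.
  apply: (@telescoping_rsum _ _ (fun x => complex.Re (W x))) => //.
    rewrite (_ : (fun x => _) = fun x => complex.Re (f (x + 1) * conjc (g x)) -
        complex.Re (f x * conjc (g (x + 1)))); last first.
      by apply/funext => x; rewrite cReD cReN.
    by apply: rsummableD; [|apply: rsummableN]; exact: rsummable_ReMJ.
  by move=> x; rewrite green cReD (cReD (W x)) cReN.
apply: (@telescoping_rsum _ _ (fun x => complex.Im (W x))) => //.
  rewrite (_ : (fun x => _) = fun x => complex.Im (f (x + 1) * conjc (g x)) -
      complex.Im (f x * conjc (g (x + 1)))); last first.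
    by apply/funext => x; rewrite cImD cImN.
  by apply: rsummableD; [|apply: rsummableN]; exact: rsummable_ImMJ.
by move=> x; rewrite green cImD (cImD (W x)) cImN.
Qed.

Lemma jacobi_symmetric v f g : ell2 f -> ell2 g ->
  ell2 (jacobi v f) -> ell2 (jacobi v g) ->
  ell2inner (jacobi v f) g = ell2inner f (jacobi v g).
Proof.
move=> f2 g2 Tf Tg; apply: jacobi_green => //.
- exact: rsummable_ReMJ.
- exact: rsummable_ImMJ.
- exact: rsummable_ReMJ.
- exact: rsummable_ImMJ.
Qed.

Definition delta (y : int) : int -> R[i] := fun x => (x == y)%:R.

Lemma delta_ell2_0 y : ell2_0 (delta y).
Proof.
apply: sub_finite_set (finite_set1 y) => x /=.
by rewrite pnatr_eq0 eqb0 negbK => /eqP.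
Qed.

Lemma ell2inner_delta y g : ell2inner (delta y) g = conjc (g y).
Proof.
rewrite /ell2inner !(@rsum_single _ _ _ y).
- by rewrite /delta eqxx mul1r; case: (g y).
- by move=> x xy; rewrite /delta (negPf xy) mul0r.
- by move=> x xy; rewrite /delta (negPf xy) mul0r.
Qed.

(** Testing an element [(f, g)] of the adjoint against the point mass at [y]
    gives [g y = jacobi v f y]: Green's identity applies although [jacobi v f] is
    not yet known to be square summable, because the point mass makes its right
    side a finite sum. The other inclusion is the symmetry of the maximal
    operator. *)
Lemma selfadjoint_jacobi_max v : selfadjoint (jacobi_max v).
Proof.
split.
  move=> f f2 e e0.
  have [|A finA [Af _]] := ell2_trunc2 f2 f2 (e := e ^+ 2).
    by rewrite exprn_gt0.
  have u0 := trunc_ell2_0 f finA.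
  exists (trunc A f, jacobi v (trunc A f)).
    by apply: ell2_0_sub_jacobi_max.
  by apply/ell2norm_lt => //; split => //; apply: ell2B => //; exact: ell2_0_ell2.
apply/seteqP; split=> [[f g] [/= f2 g2 adj]|[f g] [/= f2 g2 gE]]; last first.
  split => // -[p q] [/= p2 q2 qE].
  by rewrite qE gE jacobi_symmetric -?qE -?gE.
split => //=; apply/funext => y.
have d0 := delta_ell2_0 y; have d2 := ell2_0_ell2 d0.
have fin (h : int -> R) : (forall x, x != y -> h x = 0) -> rsummable h.
  by move=> hy; apply: (rsummable_finite (finite_set1 y)) => x /eqP; exact: hy.
have := adj (delta y, jacobi v (delta y)).
rewrite /= jacobi_green//.
- rewrite !ell2inner_delta => /(_ (ell2_0_sub_jacobi_max _)) E.
  by apply: (can_inj (@conjcK R)); rewrite E.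
- by apply: rsummable_ReMJ => //; exact: ell2_0_jacobi.
- by apply: rsummable_ImMJ => //; exact: ell2_0_jacobi.
- by apply: fin => x xy; rewrite /delta (negPf xy) mul0r.
- by apply: fin => x xy; rewrite /delta (negPf xy) mul0r.
Qed.

(** Since the operator is symmetric, ((T - lambda) f, f) has imaginary part
    - Im lambda |f|^2, whence |Im lambda| |f| <= |(T - lambda) f|. Multiplying the
    equation (T - lambda) f = g by the conjugate of [f] asks for it only where
    [f] does not vanish, so that the bound applies to finite sections of the
    operator as well. *)
Lemma jacobi_energy v lambda f g : ell2 f -> ell2 (jacobi v f) -> ell2 g ->
  (forall x, g x * conjc (f x) = (jacobi v f x - lambda * f x) * conjc (f x)) ->
  complex.Im lambda ^+ 2 * ell2sq f <= ell2sq g.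
Proof.
move=> f2 Tf2 g2 gE; set eta := complex.Im lambda.
pose P x := complex.Im (jacobi v f x * conjc (f x)).
have sP : rsummable P by exact: rsummable_ImMJ.
have P0 : rsum P = 0.
  have [_] := jacobi_symmetric f2 f2 Tf2 Tf2.
  rewrite -/P (_ : (fun x => complex.Im (f x * _)) = fun x => - P x); last first.
    apply/funext => x; rewrite /P !ReImE.
    by case: (f x) (jacobi v f x) => a b [c d] /=; ring.
  by rewrite rsumN// => PP; lra.
move: (f2) (g2) => /ell2P sf /ell2P sg.
have -> : ell2sq g = 2 * eta * rsum P + ell2sq g by rewrite P0 mulr0 add0r.
rewrite /ell2sq -!rsumZ// -rsumD//; last exact: rsummableZ.
apply: le_rsum; [|exact: rsummableZ|by apply: rsummableD => //; exact: rsummableZ].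
move=> x; have := gE x; rewrite /P; move: (jacobi v f x) => Tfx.
move=> /(congr1 (@complex.Im R)); rewrite /sqmod !ReImE -/eta.
move: (complex.Re lambda) => l.
case: (f x) (g x) Tfx => a b [c d] [p q] /= E; rewrite -subr_ge0.
(* The right side minus the left side is |g + i eta f|^2. *)
have -> : 2 * eta * (p * - b + q * a) + (c ^+ 2 + d ^+ 2) -
    eta ^+ 2 * (a ^+ 2 + b ^+ 2) = (c - eta * b) ^+ 2 + (d + eta * a) ^+ 2.
  have -> : p * - b + q * a = c * - b + d * a + eta * (a ^+ 2 + b ^+ 2).
    by rewrite E; ring.
  by ring.
by rewrite addr_ge0 ?sqr_ge0.
Qed.

End Jacobi.

(** * Resolvents of Jacobi operators *)

Section FiniteSections.
Context {R : realType}.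
Context (v : int -> R) (lambda : R[i]).
Context (lambda_nreal : complex.Im lambda != 0).
Implicit Types (f g : int -> R[i]).

(** The compression of [T - lambda] to a finite set of sites is a square matrix;
    it is injective by the energy bound, hence invertible. *)
Lemma finite_section n (e : 'I_n -> int) g : injective e ->
  exists f, [/\ forall x, (forall i, x != e i) -> f x = 0 &
    forall i, jacobi v f (e i) - lambda * f (e i) = g (e i)].
Proof.
move=> inje.
pose ext (u : 'rV[R[i]]_n) x := \sum_(j < n) u 0 j * (x == e j)%:R.
have extE u i : ext u (e i) = u 0 i.
  rewrite /ext (bigD1 i)//= eqxx mulr1 big1 ?addr0// => j ji.
  by rewrite (inj_eq inje) eq_sym (negPf ji) mulr0.
have ext_out u x : (forall i, x != e i) -> ext u x = 0.
  by move=> xe; rewrite /ext big1// => j _; rewrite (negPf (xe j)) mulr0.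
have ext0 u : ell2_0 (ext u).
  apply: (@sub_finite_set _ _ [set` [seq e i | i <- enum 'I_n]]).
    move=> x /= ux; apply: contraNT ux => xe; apply/eqP/ext_out => i.
    by apply: contra xe => /eqP ->; rewrite map_f// mem_enum.
  exact: finite_seq.
pose phi u := \row_i (jacobi v (ext u) (e i) - lambda * ext u (e i)).
have phi_linear : linear phi.
  move=> a u w; apply/rowP => i; rewrite !mxE.
  have extL x : ext (a *: u + w) x = a * ext u x + ext w x.
    rewrite /ext mulr_sumr -big_split/=; apply: eq_bigr => j _.
    by rewrite !mxE; ring.
  by rewrite /jacobi !extL; ring.
pose phiL : {linear 'rV[R[i]]_n -> 'rV[R[i]]_n} :=
  HB.pack phi (GRing.isLinear.Build _ _ _ _ phi phi_linear).
have phi_inj u : phi u = 0 -> u = 0.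
  move=> phiu0; have u2 := ell2_0_ell2 (ext0 u).
  suff ux0 : ext u = (fun=> 0) by apply/rowP => i; rewrite -extE ux0 mxE.
  apply: ell2sq_eq0 => //.
  have /= := @jacobi_energy _ v lambda _ (fun=> 0) u2 (ell2_0_jacobi v (ext0 u)).
  have z0 : ell2sq (fun _ : int => 0 : R[i]) = 0.
    by rewrite /ell2sq (@rsum_single _ int _ 0) ?sqmod0// => x _;
      rewrite sqmod0.
  rewrite z0 pmulr_rle0; last first.
    by rewrite lt_neqAle eq_sym sqrf_eq0 lambda_nreal sqr_ge0.
  apply.
    apply: ell2_0_ell2; rewrite /ell2_0/= (_ : mkset _ = set0)//.
    by apply/seteqP; split => x //=; rewrite eqxx.
  move=> x; have [/existsP[i /eqP ->]|/existsPn xe] := boolP [exists i, x == e i].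
    by have /rowP/(_ i) := phiu0; rewrite !mxE => ->; rewrite !mul0r.
  by rewrite (ext_out _ _ xe) conjc0 !mulr0.
have free : row_free (lin1_mx phiL).
  by apply: inj_row_free => u; rewrite mul_rV_lin1; exact: phi_inj.
pose u := \row_i g (e i) *m invmx (lin1_mx phiL).
have phiu : phi u = \row_i g (e i).
  by rewrite -[phi]/(phiL : _ -> _) -mul_rV_lin1 mulmxKV// -row_free_unit.
exists (ext u); split; first exact: ext_out.
by move=> i; have /rowP/(_ i) := phiu; rewrite !mxE.
Qed.

(** Exhausting the lattice by intervals gives approximate solutions, bounded
    uniformly in norm by the energy estimate. *)
Lemma approximate_resolvent g : ell2 g ->
  exists fs : nat -> int -> R[i],
    [/\ forall N, ell2 (fs N),
        forall N, complex.Im lambda ^+ 2 * ell2sq (fs N) <= ell2sq g &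
        forall N (x : int), (`|x| <= N)%N ->
          jacobi v (fs N) x - lambda * fs N x = g x].
Proof.
move=> g2.
have : forall N : nat, exists f : int -> R[i],
    [/\ ell2 f, complex.Im lambda ^+ 2 * ell2sq f <= ell2sq g &
        forall x : int, (`|x| <= N)%N -> jacobi v f x - lambda * f x = g x].
  move=> N; pose e (i : 'I_(N + N).+1) : int := (i : nat)%:Z - N%:Z.
  have inje : injective e.
    by move=> i j /(congr1 (fun z => z + N%:Z)); rewrite !subrK => -[/val_inj].
  have [f [fout feq]] := finite_section g inje.
  have f0 : ell2_0 f.
    apply: (@sub_finite_set _ _ [set` [seq e i | i <- enum 'I_(N + N).+1]]).
      move=> x /= fx; apply: contraNT fx => xe; apply/eqP/fout => i.
      by apply: contra xe => /eqP ->; rewrite map_f// mem_enum.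
    exact: finite_seq.
  exists f; split; first exact: ell2_0_ell2.
    apply: (@jacobi_energy _ v) => //; first exact: ell2_0_ell2.
      exact: ell2_0_jacobi.
    move=> x; have [/existsP[i /eqP ->]|/existsPn xe] := boolP [exists i, x == e i].
      by rewrite feq.
    by rewrite (fout _ xe) conjc0 !mulr0.
  move=> x xN; have xN' : (`|(x + N%:Z)%R| < (N + N).+1)%N by lia.
  have xN0 : 0 <= x + N%:Z by lia.
  have -> : x = e (Ordinal xN') by rewrite /e /= gez0_abs// addrK.
  exact: feq.
by move=> /choice[fs fsP]; exists fs; split => N; have [] := fsP N.
Qed.

End FiniteSections.

(** A bounded sequence has a cluster point along the ultrafilter; it is a limit,
    because an ultrafilter that does not contain the preimage of a neighbourhood
    contains the complement of this preimage. *)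
Lemma ultra_bounded_cvg (R : realType) (U : set_system nat) (a : nat -> R)
    (B : R) :
  UltraFilter U -> (forall N, `|a N| <= B) -> exists l : R, a @ U --> l.
Proof.
move=> UU aB; have aU : U (a @^-1` `[- B, B]%classic).
  by apply: filterE => N /=; rewrite in_itv/= -ler_norml.
have [l [_ cl]] := @segment_compact R (- B) B (a @ U) _ aU; exists l => A Al.
have [//|UA] := in_ultra_setVsetC (a @^-1` A) UU.
by have [y []] := cl (~` A) A UA Al.
Qed.

Section Resolvent.
Context {R : realType}.
Context (v : int -> R) (lambda : R[i]).
Context (lambda_nreal : complex.Im lambda != 0).
Implicit Types (f g : int -> R[i]).

(** Along an ultrafilter, the finite-section solutions have a pointwise limit.
    It solves the equation, which at each site involves three values only, and
    it is square summable because its finite partial sums are limits of partial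
    sums that obey the uniform bound. *)
Lemma jacobi_solve g : ell2 g ->
  exists2 f, ell2 f & forall x, jacobi v f x = g x + lambda * f x.
Proof.
move=> g2; have [fs [fs2 fsb fseq]] := approximate_resolvent v lambda_nreal g2.
have eta0 : 0 < complex.Im lambda ^+ 2.
  by rewrite lt_neqAle eq_sym sqrf_eq0 lambda_nreal sqr_ge0.
pose C := ell2sq g / complex.Im lambda ^+ 2.
have fsC N : ell2sq (fs N) <= C by rewrite ler_pdivlMr// mulrC.
have [U [UU oU]] := ultraFilterLemma eventually_filter.
have bounded (r : R) : r ^+ 2 <= C -> `|r| <= C + 1.
  move=> rC; have [|r1] := leP `|r| 1.
    by move=> /le_trans; apply; rewrite lerDr (le_trans _ rC)// sqr_ge0.
  rewrite (le_trans (ler_peMr _ (ltW r1)))// -expr2 real_normK ?num_real//.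
  by rewrite (le_trans rC)// lerDl.
(* Convergence along the ultrafilter in R[i], coordinate by coordinate. *)
pose to (h : nat -> R[i]) (z : R[i]) := (fun N => complex.Re (h N)) @ U --> complex.Re z /\
  (fun N => complex.Im (h N)) @ U --> complex.Im z.
have toD h k z w : to h z -> to k w -> to (fun N => h N + k N) (z + w).
  move=> [h1 h2] [k1 k2]; rewrite /to.
  under eq_fun do rewrite cReD.
  under [X in _ /\ (X @ U --> _)]eq_fun do rewrite cImD.
  by rewrite cReD cImD; split; exact: cvgD.
have toZ a h z : to h z -> to (fun N => a * h N) (a * z).
  move=> [h1 h2]; rewrite /to.
  under eq_fun do rewrite cReM.
  under [X in _ /\ (X @ U --> _)]eq_fun do rewrite cImM.
  rewrite cReM cImM; split; [apply: cvgB|apply: cvgD];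
    apply: cvgM => //; exact: cvg_cst.
have [f fP] : exists f : int -> R[i], forall x, to (fun N => fs N x) (f x).
  suff /choice[f fP] : forall x, exists z, to (fun N => fs N x) z by exists f.
  move=> x; have sqC N : sqmod (fs N x) <= C.
    by apply: le_trans (fsC N); exact: le_ell2sq_term.
  have [|a aP] := @ultra_bounded_cvg _ U (fun N => complex.Re (fs N x)) (C + 1) UU.
    by move=> N; apply: bounded; apply: le_trans (sqC N); rewrite lerDl sqr_ge0.
  have [|b bP] := @ultra_bounded_cvg _ U (fun N => complex.Im (fs N x)) (C + 1) UU.
    by move=> N; apply: bounded; apply: le_trans (sqC N); rewrite lerDr sqr_ge0.
  by exists (Complex a b).
exists f.
  apply/ell2P; rewrite ge0_rsummable; last by move=> x; exact: sqmod_ge0.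
  rewrite ge0_fin_numE; last by apply: esum_ge0 => x _; rewrite lee_fin sqmod_ge0.
  apply: (@le_lt_trans _ _ C%:E); last exact: ltry.
  apply: ge_ereal_sup => _ [X [finX _] <-].
  rewrite fsbig_finite// sumEFin lee_fin.
  pose s := finmap.enum_fset (fset_set X).
  have lims : (fun N => \sum_(x <- s) sqmod (fs N x)) @ U -->
              \sum_(x <- s) sqmod (f x).
    apply: cvg_big => [|x _]; first exact: add_continuous.
    have [fR fI] := fP x.
    by apply: cvgD; rewrite expr2; apply: cvgM.
  apply: (cvgr_to_le lims); apply: filterE => N.
  apply: le_trans (fsC N); rewrite -lee_fin -esum_rsum.
  - apply: esum_ge; exists X; first by split.
    by rewrite fsbig_finite// sumEFin.
  - by move=> x; exact: sqmod_ge0.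
  - exact/ell2P.
move=> x.
have lim1 : to (fun N => jacobi v (fs N) x + - lambda * fs N x)
               (jacobi v f x + - lambda * f x).
  have diag := toZ (real_complex R (v x)) _ _ (fP x).
  have TfP := toD _ _ _ _ (toD _ _ _ _ (fP (x + 1)) diag) (fP (x - 1)).
  exact: toD TfP (toZ (- lambda) _ _ (fP x)).
have lim2 : to (fun N => jacobi v (fs N) x + - lambda * fs N x) (g x).
  have ev : \forall N \near U, jacobi v (fs N) x + - lambda * fs N x = g x.
    apply: oU; exists `|x|%N => // N xN; rewrite mulNr; exact: fseq.
  by split; apply: cvg_near_cst; apply: filterS ev => N ->.
suff <- : jacobi v f x + - lambda * f x = g x by rewrite mulNr subrK.
by apply: complex_ext;
  [apply: cvg_unique lim1.1 lim2.1|apply: cvg_unique lim1.2 lim2.2].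
Qed.

Lemma jacobi_resolvent g : ell2 g ->
  let f := resolvent (jacobi_max v) lambda g in
  ell2 f /\ jacobi v f = (fun x => g x + lambda * f x).
Proof.
move=> g2 /=; set P := [set f | jacobi_max v (f, fun x => g x + lambda * f x)].
suff : P (xget (fun=> 0) P) by case.
apply: xgetPex; have [f f2 fE] := jacobi_solve g2.
exists f; split => //=; first by apply: ell2D => //; exact: ell2Z.
exact/esym/funext.
Qed.

End Resolvent.

(** * Strong resolvent convergence of Jacobi operators *)

Section StrongResolvent.
Context {R : realType}.

Lemma ell2sq_diag_le (w : int -> R) (u : int -> R[i]) (k : R) :
  ell2_0 u -> (forall x, u x != 0 -> w x ^+ 2 <= k) ->
  ell2sq (fun x => real_complex R (w x) * u x) <= k * ell2sq u.
Proof.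
move=> u0 wk; have /ell2P su := ell2_0_ell2 u0.
have /ell2P swu := ell2_0_ell2 (ell2_0_diag w u0).
rewrite /ell2sq -rsumZ//; apply: le_rsum => //; last exact: rsummableZ.
move=> x; rewrite sqmodM sqmod_real; have [->|ux] := eqVneq (u x) 0.
  by rewrite sqmod0 !mulr0.
by rewrite ler_wpM2r ?sqmod_ge0// wk.
Qed.

(** If a finitely supported [u] is close to the solution [h] for the diagonal [v]
    in the graph norm, and if [v] and [w] nearly agree where [u] lives, then [k - u]
    solves the equation for the diagonal [w] with a small right side, and the
    energy bound applies. Distances enter through their squares; this is where
    the numerical factor comes from. *)
Lemma resolvent_close (v w : int -> R) (lambda : R[i]) (g h k u : int -> R[i])
    (d : R) :
  ell2 g -> ell2_0 u ->
  ell2 h -> jacobi v h = (fun x => g x + lambda * h x) ->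
  ell2 k -> jacobi w k = (fun x => g x + lambda * k x) ->
  ell2sq (fun x => u x - h x) <= d ->
  ell2sq (fun x => jacobi v u x - jacobi v h x) <= d ->
  ell2sq (fun x => real_complex R (w x - v x) * u x) <= d ->
  complex.Im lambda ^+ 2 * ell2sq (fun x => k x - u x) <=
    (6 + 4 * sqmod lambda) * d.
Proof.
move=> g2 u0 h2 hE k2 kE uh Tuh wu.
have Th2 : ell2 (jacobi v h) by rewrite hE; apply: ell2D => //; exact: ell2Z.
have Tk2 : ell2 (jacobi w k) by rewrite kE; apply: ell2D => //; exact: ell2Z.
have u2 := ell2_0_ell2 u0.
pose a x := jacobi v u x - jacobi v h x.
pose b x := lambda * (u x - h x).
pose r x := real_complex R (w x - v x) * u x.
have a2 : ell2 a by apply: ell2B => //; exact: ell2_0_jacobi.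
have uh2 : ell2 (fun x => u x - h x) by exact: ell2B.
have b2 : ell2 b by exact: ell2Z.
have r2 : ell2 r by exact/ell2_0_ell2/(ell2_0_diag (fun x => w x - v x) u0).
have ba2 := ell2B b2 a2.
(* (T_w - lambda) (k - u) = lambda (u - h) - (T_v u - T_v h) - (w - v) u. *)
have Tku : jacobi w (fun x => k x - u x) = (fun x => jacobi w k x - jacobi w u x).
  by apply/funext => x; rewrite jacobiB.
apply: (@le_trans _ _ (ell2sq (fun x => b x - a x - r x))).
  apply: (@jacobi_energy _ w); [exact: ell2B| |exact: ell2B|].
    by rewrite Tku; apply: ell2B => //; exact: ell2_0_jacobi.
  move=> x; congr (_ * _); rewrite Tku kE /b /a /r hE.
  by rewrite /jacobi rmorphB/=; ring.
have := ell2sqB ba2 r2; have := ell2sqB b2 a2.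
rewrite /b ell2sqZ// -/b.
have := ler_wpM2l (sqmod_ge0 lambda) uh.
move: Tuh wu; rewrite -/a -/r.
by move: (sqmod lambda) => L; lra.
Qed.

(** Pointwise convergence of the diagonals is convergence in norm of the operators
    on each finitely supported function; as these form a core of the limit,
    this is enough. *)
Theorem jacobi_strong_resolvent_cvg (T : Type) (F : set_system T)
    (A : T -> operator R int) (w : T -> int -> R) (v : int -> R) :
  Filter F -> (\forall t \near F, A t = jacobi_max (w t)) ->
  (forall x, (fun t => w t x) @ F --> v x) ->
  strong_resolvent_cvg F A (jacobi_max v).
Proof.
move=> FF AE wv lambda lnr g g2.
have [h2 hE] := jacobi_resolvent v lnr g2.
set h := resolvent _ _ _ in h2 hE *.
have Th2 : ell2 (jacobi v h) by rewrite hE; apply: ell2D => //; exact: ell2Z.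
have eta0 : 0 < complex.Im lambda ^+ 2.
  by rewrite lt_neqAle eq_sym sqrf_eq0 lnr sqr_ge0.
suff close (e : R) : 0 < e ->
    \forall t \near F, (ell2norm (fun x => (resolvent (A t) lambda g x - h x)%R)
                        < e%:E)%E.
  have n0 t : (0 <= ell2norm (fun x => (resolvent (A t) lambda g x - h x)%R))%E.
    exact: sqrte_ge0.
  apply/fine_cvgP; split.
    apply: filterS (close 1 ltr01) => t lt1.
    by rewrite ge0_fin_numE// (lt_trans lt1)// ltry.
  apply/cvgrPdist_lt => e e0; apply: filterS (close e e0) => t lte /=.
  rewrite sub0r normrN ger0_norm ?fine_ge0//.
  by rewrite -lte_fin fineK// ge0_fin_numE// (lt_trans lte)// ltry.
move=> e0.
(* The squared distance to the limit will be at most [K d], with [d] the accuracy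
   in [resolvent_close] and in the choice of [u]. *)
pose K := 2 * ((6 + 4 * sqmod lambda) / complex.Im lambda ^+ 2) + 2.
have K0 : 0 < K.
  have := sqmod_ge0 lambda => l0.
  by rewrite ltr_wpDl// mulr_ge0// divr_ge0 ?ltW//; lra.
pose d := e ^+ 2 / (K + 1).
have d0 : 0 < d by rewrite divr_gt0 ?exprn_gt0//; lra.
have [u [u0 uh Tuh]] := jacobi_max_core h2 Th2 d0.
have u2 := ell2_0_ell2 u0; have su0 := ell2sq_ge0 u2.
pose kappa := d / (ell2sq u + 1).
have kappa0 : 0 < kappa by rewrite divr_gt0//; lra.
have : \forall t \near F, forall x, u x != 0 -> (w t x - v x) ^+ 2 <= kappa.
  have := @filter_bigI T int (fset_set [set x | u x != 0])
    (fun x t => (w t x - v x) ^+ 2 <= kappa) F FF.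
  have finu : finite_set [set x | u x != 0] by [].
  move=> big; apply: filterS (big _) => [t tb x ux|x].
    by apply: tb => /=; rewrite in_fset_set// inE.
  move=> _; have /cvgrPdist_le/(_ (Num.sqrt kappa)) := wv x.
  rewrite sqrtr_gt0 => /(_ kappa0); apply: filterS => t.
  rewrite distrC => wle; rewrite -[leRHS](sqr_sqrtr (ltW kappa0)).
  by rewrite -[leLHS]real_normK ?num_real// ler_sqr ?nnegrE ?sqrtr_ge0.
apply: filterS2 AE => t -> tk.
have [k2 kE] := jacobi_resolvent (w t) lnr g2.
set k := resolvent _ _ _ in k2 kE *.
have wu : ell2sq (fun x => real_complex R (w t x - v x) * u x) <= d.
  apply: le_trans (ell2sq_diag_le (w := fun x => w t x - v x) u0 tk) _.
  by rewrite /kappa mulrAC ler_pdivrMr ?ler_pM2l; lra.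
have := resolvent_close g2 u0 h2 hE k2 kE (ltW uh) (ltW Tuh) wu.
rewrite mulrC -ler_pdivlMr// mulrAC => ku.
apply/ell2norm_lt => //; split; first exact: ell2B.
have -> : (fun x => k x - h x) = (fun x => (k x - u x) + (u x - h x)).
  by apply/funext => x; rewrite addrA subrK.
have kuh := ell2sqD (ell2B k2 u2) (ell2B u2 h2).
have -> : e ^+ 2 = (K + 1) * d by rewrite /d mulrCA divff ?mulr1// gt_eqF//; lra.
apply: le_lt_trans kuh _; rewrite /K.
by move: (_ / complex.Im lambda ^+ 2) ku => q ku; lra.
Qed.

End StrongResolvent.

(** * Reindexing and scaling of closures *)

Section Transfer.
Context {R : realType} {I J : choiceType}.
Context {phi : J -> I} {psi : I -> J}.
Context (phiK : cancel phi psi) (psiK : cancel psi phi).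

Let bphi : bijective phi. Proof. by exists psi. Qed.

Lemma ell2_reindex (f : I -> R[i]) : ell2 f -> ell2 (f \o phi).
Proof. by rewrite /ell2/= ell2norm_reindex. Qed.

Lemma op_transfer_closure_sub (A : operator R I) :
  op_transfer phi (op_closure A) `<=` op_closure (op_transfer phi A).
Proof.
move=> _ [[f g] [/= f2 g2 cl] <-]; split => /=; try exact: ell2_reindex.
move=> e e0; have [[p q] Apq [/= pf qg]] := cl e e0.
exists (p \o phi, q \o phi); first by exists (p, q).
by split => /=; [rewrite -(ell2norm_reindex bphi) in pf|
                 rewrite -(ell2norm_reindex bphi) in qg].
Qed.

End Transfer.

(** Reindexing is isometric; the inclusion for the inverse bijection gives the
    other half. *)
Lemma op_transfer_closure (R : realType) (I J : choiceType) (phi : J -> I)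
    (A : operator R I) : bijective phi ->
  op_transfer phi (op_closure A) = op_closure (op_transfer phi A).
Proof.
move=> [psi phiK psiK]; have comp (B : operator R J) p : B p ->
    op_transfer phi (op_transfer psi B) p.
  move=> Bp; exists (p.1 \o psi, p.2 \o psi); first by exists p.
  by case: p Bp => f g _ /=; congr pair; apply/funext => x /=; rewrite phiK.
apply/seteqP; split; first exact: (op_transfer_closure_sub phiK psiK).
move=> p /comp[q /(op_transfer_closure_sub psiK phiK)[q1 q2 cl] <-].
exists q => //; split=> // e e0; have [_ [_ [r Ar <-] <-] rq] := cl e e0.
exists r => //; case: rq => r1 r2.
by split; [move: r1|move: r2]; congr (ell2norm _ < _)%E;
  apply/funext => y /=; rewrite psiK.
Qed.

Lemma op_scale_closure_sub (R : realType) (I : choiceType) (a : R[i])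
    (A : operator R I) :
  op_scale a (op_closure A) `<=` op_closure (op_scale a A).
Proof.
move=> _ [[f g] [/= f2 g2 cl] <-]; split => //=; first exact: ell2Z.
move=> e e0; have m0 := sqmod_ge0 a.
(* Both [e'] and [|a| e'] are at most [e]. *)
pose e' := e / (1 + sqmod a).
have e'0 : 0 < e' by rewrite divr_gt0//; lra.
have e'E : e = e' * (1 + sqmod a) by rewrite /e' divfK// gt_eqF//; lra.
have [[p q] Apq [/= pf qg]] := cl e' e'0.
exists (p, fun x => a * q x); first by exists (p, q).
split => /=; first by apply: (lt_le_trans pf); rewrite lee_fin e'E ler_peMr//; lra.
move: qg => /(ell2norm_lt _ e'0)[qg2 qg].
apply/ell2norm_lt => //.
have -> : (fun x => a * q x - a * g x) = (fun x => a * (q x - g x)).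
  by apply/funext => x; rewrite mulrBr.
split; first exact: ell2Z.
rewrite ell2sqZ// e'E exprMn.
apply: (@le_lt_trans _ _ (sqmod a * e' ^+ 2)); first by rewrite ler_wpM2l// ltW.
by rewrite mulrC ltr_pM2l ?exprn_gt0//; nra.
Qed.

Lemma op_scale_closure (R : realType) (I : choiceType) (a : R[i])
    (A : operator R I) : a != 0 ->
  op_scale a (op_closure A) = op_closure (op_scale a A).
Proof.
move=> a0; have comp b c (B : operator R I) : b * c = 1 ->
    op_scale b (op_scale c B) = B.
  move=> bc; apply/seteqP; split => [_ [_ [[f g] Bfg <-] <-]|[f g] Bfg] /=.
    rewrite (_ : (fun x => _) = g)//.
    by apply/funext => x; rewrite mulrA bc mul1r.
  exists (f, fun x => c * g x); first by exists (f, g).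
  by congr pair; apply/funext => x /=; rewrite mulrA bc mul1r.
apply/seteqP; split; first exact: op_scale_closure_sub.
rewrite -[X in X `<=` _](comp a a^-1) ?mulfV// => _ [q Aq <-].
exists q => //; have := op_scale_closure_sub Aq.
by rewrite comp// mulVf.
Qed.

(** * The Bessel and sine operators *)

Section BesselSine.
Context {R : realType}.

Definition bessel_diag (theta : R) (x0 : halfint) (y : int) : R :=
  - (hval R (hshift x0 y) / Num.sqrt theta).

Lemma bijective_hshift (x0 : halfint) : bijective (hshift x0).
Proof.
exists (fun h => hfloor h - hfloor x0) => [y|[n]]; first by rewrite /= addrC addKr.
by rewrite /hshift /= addrC subrK.
Qed.

Lemma D_bessel_rescaledE (theta : R) (x0 : halfint) : 0 < theta ->
  D_bessel_rescaled theta x0 = jacobi_max (bessel_diag theta x0).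
Proof.
move=> theta0; have s0 : 0 < Num.sqrt theta by rewrite sqrtr_gt0.
have sn0 : Num.sqrt theta != 0 by rewrite gt_eqF.
have [psi phiK psiK] := bijective_hshift x0.
have a0 : real_complex R (Num.sqrt theta)^-1 != 0.
  by rewrite eq_complex/= negb_and invr_eq0 sn0.
rewrite /D_bessel_rescaled /D_bessel op_scale_closure//.
rewrite op_transfer_closure; last exact: bijective_hshift.
rewrite -closure_jacobi; congr op_closure.
have act (f : halfint -> R[i]) y :
    real_complex R (Num.sqrt theta)^-1 * bessel_diff theta f (hshift x0 y) =
    jacobi (bessel_diag theta x0) (f \o hshift x0) y.
  have sh k : hshift (hshift x0 y) k = hshift x0 (y + k).
    by rewrite /hshift/= addrA.
  rewrite /bessel_diff /jacobi !sh /= /bessel_diag.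
  have ss : real_complex R (Num.sqrt theta)^-1 * real_complex R (Num.sqrt theta) = 1.
    by rewrite -rmorphM/= mulVf.
  rewrite mulrDr mulrBr !mulrA ss !mul1r -rmorphM/= rmorphN/= mulNr.
  by rewrite (mulrC _^-1).
have supp (K L : choiceType) (s : K -> L) (t : L -> K) (f : L -> R[i]) :
    cancel s t -> cancel t s -> ell2_0 f -> ell2_0 (f \o s).
  move=> sK tK f0; apply: (sub_finite_set _ (finite_image t f0)) => x /= fx.
  by exists (s x) => //; rewrite sK.
apply/seteqP; split => [_ [_ [[f g] [/= f0 ->] <-] <-]|[f g] [/= f0 ->]] /=.
  by split => /=; [exact: supp f0|apply/funext => y; rewrite /= act].
pose p := f \o psi.
exists (p, fun x => real_complex R (Num.sqrt theta)^-1 * bessel_diff theta p x).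
  by exists (p, bessel_diff theta p) => //; split => //=; exact: supp f0.
have pK : p \o hshift x0 = f by apply/funext => y; rewrite /p /= phiK.
by congr pair => //; apply/funext => y; rewrite /= act pK.
Qed.

Lemma D_sineE (c : R) : D_sine c = jacobi_max (fun=> - (2 * c)).
Proof.
rewrite /D_sine -closure_jacobi; congr (op_closure (op_restrict _ _)).
by apply/funext => f; apply/funext => x; rewrite /sine_diff /jacobi rmorphN mulNr.
Qed.

Lemma cvg_bessel_diag (c : R) (x : R -> halfint) (y : int) :
  (exists M : R, \forall theta \near +oo,
     `|hval R (x theta) - 2 * c * Num.sqrt theta| <= M) ->
  (fun theta => bessel_diag theta (x theta) y) @ +oo --> - (2 * c).
Proof.
move=> [M xM]; apply/cvgrPdist_lt => e e0.
(* The distance to the limit is at most [(|M| + |y|) / sqrt theta]. *)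
pose K := (`|M| + `|y%:~R|) / e.
have K0 : 0 <= K by rewrite divr_ge0 ?addr_ge0// ltW.
near=> theta.
have Kt : K ^+ 2 < theta by near: theta; apply: nbhs_pinfty_gt; exact: num_real.
have t0 : 0 < theta by rewrite (le_lt_trans _ Kt)// sqr_ge0.
have s0 : 0 < Num.sqrt theta by rewrite sqrtr_gt0.
have Ks : K < Num.sqrt theta.
  by rewrite -(ger0_norm K0) -sqrtr_sqr ltr_sqrt.
have -> : - (2 * c) - bessel_diag theta (x theta) y =
    (hval R (x theta) - 2 * c * Num.sqrt theta + y%:~R) / Num.sqrt theta.
  by rewrite /bessel_diag hvalD; field; rewrite gt_eqF.
rewrite normrM normfV (ger0_norm (ltW s0)) ltr_pdivrMr//.
apply: le_lt_trans (ler_normD _ _) _.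
apply: (@le_lt_trans _ _ (`|M| + `|y%:~R|)).
  rewrite lerD2r; apply: le_trans (ler_norm M); near: theta; exact: xM.
by rewrite mulrC -ltr_pdivrMr.
Unshelve. all: by end_near. Qed.

End BesselSine.

Theorem proposition4p6 (R : realType) (c : R) (hc : -1 < c < 1)
    (x : R -> halfint)
    (hx : exists M : R, \forall theta \near +oo,
        `|hval R (x theta) - 2 * c * Num.sqrt theta| <= M) :
  [/\ forall theta : R, 0 < theta ->
        selfadjoint (D_bessel_rescaled theta (x theta)),
      selfadjoint (D_sine c) &
      strong_resolvent_cvg +oo
        (fun theta : R => D_bessel_rescaled theta (x theta)) (D_sine c)].
Proof.
split=> [theta theta0||].
- by rewrite D_bessel_rescaledE//; exact: selfadjoint_jacobi_max.
- by rewrite D_sineE; exact: selfadjoint_jacobi_max.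
rewrite D_sineE; apply: (jacobi_strong_resolvent_cvg
  (w := fun theta => bessel_diag theta (x theta))).
  near=> theta; apply: D_bessel_rescaledE; near: theta.
  exact: nbhs_pinfty_gt.
by move=> y; exact: cvg_bessel_diag.
Unshelve. all: by end_near. Qed.
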